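(* Let $A$ be an integral domain with fraction field $\mathcal{K}(A)$ and let $f\in A$. The following properties are equivalent: (1) $f\geq 0$ on $\operatorname{Spec}_cA$. (2) $f\geq 0$ on $\operatorname{Spec}_{pc}A$. (3) $f\in\sum\mathcal{K}(A)^2$.
   Context: All rings are commutative and contain $\mathbb{Q}$. $\sum\mathcal{K}(A)^2$ is the set of sums of squares of elements of $\mathcal{K}(A)$. A cone of a ring $B$ is a subset $P\subset B$ with $P+P\subset P$, $P\cdot P\subset P$ and $b^2\in P$ for all $b\in B$; it is proper if $-1\notin P$. An ordering of $B$ is a proper cone $P$ such that $ab\in P$ implies $a\in P$ or $-b\in P$; $\operatorname{Spec}_rB$ is the set of orderings of $B$. For $\alpha\in\operatorname{Spec}_rA$, write $P_\alpha$ for the corresponding cone and $\operatorname{supp}(\alpha)=P_\alpha\cap -P_\alpha$; for $a\in A$, $a(\alpha)\geq 0$ means $a\in P_\alpha$ and $a(\alpha)>0$ means $a\in P_\alpha\setminus\operatorname{supp}(\alpha)$. $\operatorname{Spec}_rA$ carries the topology generated by the sets $\{\alpha\mid f_1(\alpha)>0,\ldots,f_k(\alpha)>0\}$, $f_i\in A$. The map $Q\mapsto Q\cap A$ identifies $\operatorname{Spec}_r\mathcal{K}(A)$ with the set of orderings of $A$ with support $(0)$. An ordering of $A$ is central if it belongs to $\operatorname{Spec}_cA:=\overline{\operatorname{Spec}_r\mathcal{K}(A)}$ (closure in $\operatorname{Spec}_rA$). An ordering $\alpha$ of $A$ is precentral if $A\cap\sum\mathcal{K}(A)^2\subset P_\alpha$;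 $\operatorname{Spec}_{pc}A$ is the set of precentral orderings. *)

(* Defs.v *)
From HB Require Import structures.
From mathcomp Require Import all_boot all_algebra finmap.
From mathcomp Require Import boolp classical_sets topology.

Set Implicit Arguments.
Unset Strict Implicit.
Unset Printing Implicit Defensive.

Import GRing.Theory.
Local Open Scope classical_set_scope.
Local Open Scope ring_scope.

Section RealSpectrum.
Variable B : comPzRingType.
Implicit Type P : set B.

Definition is_cone P : Prop :=
  [/\ forall a b, P a -> P b -> P (a + b),
      forall a b, P a -> P b -> P (a * b)
    & forall b, P (b ^+ 2)].

Definition proper P : Prop := ~ P (-1).

Definition is_ordering P : Prop :=
  [/\ is_cone P, proper P & forall a b, P (a * b) -> P a \/ P (- b)].

Record specr : Type := Specr {
  pos_cone : set B;
  pos_coneP : is_ordering pos_cone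
}.

HB.instance Definition _ := gen_eqMixin specr.
HB.instance Definition _ := gen_choiceMixin specr.

Definition supp (alpha : specr) : set B :=
  [set a | pos_cone alpha a /\ pos_cone alpha (- a)].

Definition nonneg_at (a : B) (alpha : specr) : Prop := pos_cone alpha a.

Definition pos_at (a : B) (alpha : specr) : Prop :=
  (pos_cone alpha `\` supp alpha) a.

Definition nonneg_on (a : B) (S : set specr) : Prop :=
  forall alpha, S alpha -> nonneg_at a alpha.

Definition basic_open (fs : {fset B}) : set specr :=
  [set alpha | forall f, f \in fs -> pos_at f alpha].

Lemma basic_open_cover : \bigcup_(fs in [set: {fset B}]) basic_open fs = setT.
Proof. by rewrite -subTset => alpha _; exists fset0. Qed.

Lemma basic_open_join (fs gs : {fset B}) (alpha : specr) :
  [set: {fset B}] fs -> [set: {fset B}] gs ->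
  basic_open fs alpha -> basic_open gs alpha ->
  exists hs, [/\ [set: {fset B}] hs, basic_open hs alpha
                & basic_open hs `<=` basic_open fs `&` basic_open gs].
Proof.
move=> _ _ fsa gsa; exists (fs `|` gs)%fset; split=> //.
  by move=> f /fsetUP[/fsa|/gsa].
by move=> beta hb; split=> f ff; apply: hb; rewrite in_fsetU ff ?orbT.
Qed.

HB.instance Definition _ :=
  isBaseTopological.Build specr basic_open_cover basic_open_join.

End RealSpectrum.

Section Contraction.
Variables (B C : comPzRingType) (phi : {rmorphism B -> C}).

Lemma contraction_ordering (Q : specr C) :
  is_ordering (phi @^-1` pos_cone Q).
Proof.
case: Q => Q [[QD QM Q2] Qp Qo] /=; split; first split.
- by move=> a b Qa Qb; rewrite /preimage/= rmorphD; apply: QD.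
- by move=> a b Qa Qb; rewrite /preimage/= rmorphM; apply: QM.
- by move=> b; rewrite /preimage/= rmorphXn; apply: Q2.
- by rewrite /proper /preimage/= rmorphN1.
- by move=> a b; rewrite /preimage/= rmorphM rmorphN; apply: Qo.
Qed.

Definition contraction (Q : specr C) : specr B :=
  Specr (contraction_ordering Q).

End Contraction.

Definition sums_of_squares (B : comPzRingType) : set B :=
  [set x | exists s : seq B, x = \sum_(y <- s) y ^+ 2].

Section Central.
Variable A : idomainType.

Local Notation "x %:F" := (@FracField.tofrac A x).

(* The range below is the copy of Spec_r K(A) inside Spec_r A, each ordering
   of the fraction field being sent to its intersection with A. *)
Definition central : set (specr A) :=
  closure (range (contraction (@FracField.tofrac A))).

Definition precentral : set (specr A) :=
  [set alpha | forall a : A,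
     sums_of_squares a%:F -> pos_cone alpha a].

End Central.

(* Main.v *)
Require Import Defs.
From mathcomp Require Import all_boot all_algebra.
From mathcomp Require Import boolp classical_sets topology.
From mathcomp Require Import finmap ring.

Set Implicit Arguments.
Unset Strict Implicit.
Unset Printing Implicit Defensive.

Import GRing.Theory.
Local Open Scope classical_set_scope.
Local Open Scope ring_scope.

(** All three conditions say that [f] is nonnegative at every contraction to
[A] of an ordering of the fraction field [K].

The main input is Artin's theorem, [nonneg_on_field_sums_of_squares]: an
element of [K] that lies in every ordering of [K] is a sum of squares in [K].
It holds because a cone of [K] which is maximal among those avoiding [f] is an
ordering ([maximal_cone_total], [total_cone_ordering]), and Zorn's lemma gives
such a cone above the sums of squares as soon as [f] is not one of them.

Every contraction is both central and precentral, so nonnegativity on either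
kind of orderings makes [f] a sum of squares in [K].  Conversely, a sum of
squares is nonnegative on the precentral orderings by their very definition,
in particular on the contractions; since the orderings at which [f] is
nonnegative form a closed set ([nonneg_on_closure]), it is then nonnegative on
the central ones. *)

(** * Cones of a ring *)

Section Cones.
Context {B : comPzRingType}.
Implicit Type P : set B.

Lemma cone0 P : is_cone P -> P 0.
Proof. by case=> _ _ /(_ 0); rewrite expr0n. Qed.

Lemma cone1 P : is_cone P -> P 1.
Proof. by case=> _ _ /(_ 1); rewrite expr1n. Qed.

Lemma sums_of_squares_cone : is_cone (sums_of_squares (B := B)).
Proof.
split.
- by move=> _ _ [s ->] [t ->]; exists (s ++ t); rewrite big_cat.
- move=> _ _ [s ->] [t ->]; exists [seq y * z | y <- s, z <- t].
  rewrite big_distrlr big_allpairs_dep/=.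
  by apply: eq_bigr => y _; apply: eq_bigr => z _; rewrite exprMn.
- by move=> b; exists [:: b]; rewrite big_seq1.
Qed.

Lemma sums_of_squares_sub_cone P : is_cone P -> sums_of_squares (B := B) `<=` P.
Proof.
move=> coneP _ [s ->]; have [PD _ P2] := coneP.
by apply: big_rec => [|y x _ Px]; [exact: cone0 | exact: PD].
Qed.

(** The cone generated by [P] and [a], for a cone [P]: higher powers of [a]
bring nothing new, since [a ^+ 2] is already in [P]. *)
Definition adjoin P (a : B) : set B :=
  [set x | exists p q, [/\ P p, P q & x = p + a * q]].

Lemma adjoin_cone P a : is_cone P -> is_cone (adjoin P a).
Proof.
move=> coneP; have [PD PM P2] := coneP; split.
- move=> _ _ [p [q [Pp Pq ->]]] [r [s [Pr Ps ->]]].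
  exists (p + r), (q + s); split; [exact: PD|exact: PD|by ring].
- move=> _ _ [p [q [Pp Pq ->]]] [r [s [Pr Ps ->]]].
  exists (p * r + a ^+ 2 * (q * s)), (p * s + q * r); split; last by ring.
  + by apply: PD; [exact: PM | apply: (PM) => //; exact: PM].
  + by apply: PD; exact: PM.
- move=> b; exists (b ^+ 2), 0; split; [exact: P2|exact: cone0|by ring].
Qed.

Lemma sub_adjoin P a : is_cone P -> P `<=` adjoin P a.
Proof. by move=> /cone0 P0 p Pp; exists p, 0; rewrite mulr0 addr0. Qed.

Lemma mem_adjoin P a : is_cone P -> adjoin P a a.
Proof.
by move=> coneP; exists 0, 1; rewrite mulr1 add0r; split=> //;
  [exact: cone0 | exact: cone1].
Qed.

Lemma ordering_total (alpha : specr B) a :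
  pos_cone alpha a \/ pos_cone alpha (- a).
Proof.
by case: (pos_coneP alpha) => [[_ _ P2] _ Po]; apply: Po; rewrite -expr2.
Qed.

(** By totality of orderings, [f] fails to be nonnegative exactly on the basic
open set where [- f] is positive. *)
Lemma nonneg_on_closure (f : B) (S : set (specr B)) :
  nonneg_on f S -> nonneg_on f (closure S).
Proof.
move=> fS alpha Salpha; rewrite /nonneg_at.
have [//|Nf] := ordering_total alpha f.
apply: contrapT => nf.
have /Salpha[beta [Sbeta /(_ (- f))]] :
    nbhs alpha (basic_open [fset (- f)]%fset).
  apply: open_nbhs_nbhs; split.
    exists [set [fset (- f)]%fset] => //.
    by rewrite bigcup_set1.
  move=> g; rewrite in_fset1 => /eqP ->.
  by split=> // -[_]; rewrite opprK.
rewrite in_fset1 eqxx => /(_ isT)[Nfb]; apply; split=> //.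
by rewrite opprK; exact: fS.
Qed.

End Cones.

(** * Orderings of a field *)

Section Field.
Context {K : fieldType}.
Hypothesis two_neq0 : 2 != 0 :> K.
Implicit Type P T : set K.

Lemma cone_inv P x : is_cone P -> P x -> P x^-1.
Proof.
move=> coneP Px; have [_ PM P2] := coneP.
have [->|x0] := eqVneq x 0; first by rewrite invr0; exact: cone0.
have -> : x^-1 = x * x^-1 ^+ 2 by rewrite expr2 mulrA divff// mul1r.
exact: PM.
Qed.

(** Any [f] is the difference of the squares of [(f + 1) / 2] and
[(f - 1) / 2], so a cone containing [- 1] is the whole field. *)
Lemma cone_avoiding_proper P f : is_cone P -> ~ P f -> Defs.proper P.
Proof.
move=> [PD PM P2] nPf PN1; apply: nPf.
have -> : f = ((f + 1) / 2) ^+ 2 + (-1) * ((f - 1) / 2) ^+ 2 by field.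
by apply: PD => //; apply: PM.
Qed.

Lemma proper_cone_supp0 P x :
  is_cone P -> Defs.proper P -> P x -> P (- x) -> x = 0.
Proof.
move=> coneP PN1 Px PNx; apply: contrapT => /eqP x0; apply: PN1.
have [_ PM _] := coneP.
by rewrite -(divff x0) -mulNr; apply: PM => //; exact: cone_inv.
Qed.

(** When [a] is not in [P] and [- b] is not either, totality puts [- a] and [b]
in [P], so that [a * b] is in the support of [P], which is zero. *)
Lemma total_cone_ordering P : is_cone P -> Defs.proper P ->
  (forall a, P a \/ P (- a)) -> is_ordering P.
Proof.
move=> coneP PN1 Ptot; split=> // a b Pab; have [_ PM _] := coneP.
have [|PNa] := Ptot a; first by left.
have [Pb|] := Ptot b; last by right.
have /eqP : a * b = 0.
  by apply: (proper_cone_supp0 coneP) => //; rewrite -mulNr; exact: PM.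
rewrite mulf_eq0 => /orP[]/eqP ->; [left|right; rewrite oppr0]; exact: cone0.
Qed.

(** If [f = p + a q = r - a s], eliminating [a] gives
[(q + s) f = s p + q r], so [f] lies in [P] unless [q + s = 0]; in that case
[q] is in the support of [P], hence zero, and [f = p]. *)
Lemma adjoin_opp_avoiding P f a : is_cone P -> ~ P f ->
  adjoin P a f -> ~ adjoin P (- a) f.
Proof.
move=> coneP nPf [p [q [Pp Pq fpq]]] [r [s [Pr Ps frs]]]; apply: (nPf).
have [PD PM _] := coneP.
have [qs0|qs0] := eqVneq (q + s) 0.
  have q0 : q = 0.
    apply: (proper_cone_supp0 coneP (cone_avoiding_proper coneP nPf)) => //.
    by rewrite -(addr0_eq qs0) in Ps.
  by rewrite fpq q0 mulr0 addr0.
have qsf : f * (q + s) = s * p + q * r.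
  by rewrite mulrDr [in f * q]frs [in f * s]fpq; ring.
rewrite -(mulfK qs0 f) qsf.
apply: (PM); first by apply: PD; exact: PM.
by apply: cone_inv => //; exact: PD.
Qed.

(** If both [a] and [- a] were outside [P], adjoining either of them would give
a strictly larger cone, hence one containing [f]. *)
Lemma maximal_cone_total P f : is_cone P -> ~ P f ->
  (forall N, is_cone N -> ~ N f -> P `<=` N -> N `<=` P) ->
  forall a, P a \/ P (- a).
Proof.
move=> coneP nPf Pmax a.
have in_max b : ~ adjoin P b f -> P b.
  move=> nf; apply: (Pmax (adjoin P b)) => //.
  - exact: adjoin_cone.
  - exact: sub_adjoin.
  - exact: mem_adjoin.
have [fa|/in_max] := pselect (adjoin P a f); last by left.
by right; apply: in_max; exact: adjoin_opp_avoiding.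
Qed.

Lemma maximal_cone_avoiding T f : is_cone T -> ~ T f ->
  exists P, [/\ is_cone P, ~ P f, T `<=` P &
    forall N, is_cone N -> ~ N f -> P `<=` N -> N `<=` P].
Proof.
move=> coneT nTf; have [TD TM T2] := coneT.
(* The union with [T] makes the empty chain harmless: it has the bound [T]. *)
pose avoiding (X : set K) := is_cone (T `|` X) /\ ~ (T `|` X) f.
have [F Favoid Ftot|M [[coneM nMf] Mmax]] := @Zorn_bigcup K avoiding.
  have sub_union X : F X -> T `|` X `<=` T `|` \bigcup_(Y in F) Y.
    by move=> FX; apply: setUS; exact: bigcup_sup.
  have union_pair a b : (T `|` \bigcup_(Y in F) Y) a ->
      (T `|` \bigcup_(Y in F) Y) b ->
      (T a /\ T b) \/ exists2 X, F X & (T `|` X) a /\ (T `|` X) b.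
    move=> [Ta|[X FX Xa]] [Tb|[Y FY Yb]]; [by left| | |]; right.
    - by exists Y => //; split; [left|right].
    - by exists X => //; split; [right|left].
    - have [XY|YX] := Ftot _ _ FX FY.
      + by exists Y => //; split; right=> //; exact: XY.
      + by exists X => //; split; right=> //; exact: YX.
  split; first split.
  - move=> a b Ua Ub; have [[Ta Tb]|[X FX [Xa Xb]]] := union_pair a b Ua Ub.
      by left; exact: TD.
    by have [[XD _ _] _] := Favoid X FX; apply: (sub_union X FX); exact: XD.
  - move=> a b Ua Ub; have [[Ta Tb]|[X FX [Xa Xb]]] := union_pair a b Ua Ub.
      by left; exact: TM.
    by have [[_ XM _] _] := Favoid X FX; apply: (sub_union X FX); exact: XM.
  - by move=> b; left; exact: T2.
  - move=> [//|[X FX Xf]]; have [_] := Favoid X FX.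
    by apply; right.
exists (T `|` M); split=> // N coneN nNf; rewrite subUset => -[TN MN].
have TNE : T `|` N = N by apply/setUidPr.
apply: contrapT => nNM; apply: (Mmax N); last by rewrite /avoiding TNE.
by split=> // NM; apply: nNM => x /NM; right.
Qed.

(** This is Artin's theorem: if [f] is not a sum of squares, a maximal cone
avoiding [f] is an ordering at which [f] is negative. *)
Theorem nonneg_on_field_sums_of_squares (f : K) :
  nonneg_on f [set: specr K] -> sums_of_squares f.
Proof.
move=> f_ge0; apply: contrapT => nf.
have [P [coneP nPf _ Pmax]] := maximal_cone_avoiding sums_of_squares_cone nf.
have ordP : is_ordering P.
  apply: total_cone_ordering => //.
    exact: (cone_avoiding_proper coneP nPf).
  exact: (maximal_cone_total coneP nPf Pmax).
by apply: nPf; exact: (f_ge0 (Specr ordP)).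
Qed.

End Field.

(** * Contractions of the orderings of the fraction field *)

Section Domain.
Context {A : idomainType}.

Local Notation contractions :=
  (range (contraction (@FracField.tofrac A))).

Lemma contractions_sub_precentral : contractions `<=` @precentral A.
Proof.
move=> _ [Q _ <-] a; apply: sums_of_squares_sub_cone.
by have [] := pos_coneP Q.
Qed.

Lemma nonneg_on_contractions (f : A) : (2 : A) != 0 ->
  nonneg_on f contractions -> sums_of_squares (FracField.tofrac f).
Proof.
move=> two_neq0 f_ge0; apply: nonneg_on_field_sums_of_squares.
  by rewrite -(rmorph_nat (@FracField.tofrac A)) tofrac_eq0.
by move=> Q _; apply: (f_ge0 (contraction _ Q)); exists Q.
Qed.

End Domain.

Theorem theorem2 (A : idomainType) (iota : {rmorphism rat -> A}) (f : A) :
  [<-> nonneg_on f (@central A);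
       nonneg_on f (@precentral A);
       sums_of_squares (FracField.tofrac f)].
Proof.
have two_neq0 : (2 : A) != 0 by rewrite -(rmorph_nat iota) fmorph_eq0.
tfae.
- move=> f_ge0 alpha; apply; apply: nonneg_on_contractions => // beta ?.
  by apply: f_ge0; exact: subset_closure.
- move=> f_ge0; apply: nonneg_on_contractions => // beta ?.
  by apply: f_ge0; exact: contractions_sub_precentral.
- move=> f_sos; apply: nonneg_on_closure => beta /contractions_sub_precentral.
  exact.
Qed.
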